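(* Let $(\mathcal{E},i,q)$ be a twist over a Hausdorff étale groupoid $\mathcal{G}$. In each of the following, the twist structure is given by the restrictions of $i$ and $q$. (a) The groupoid $q^{-1}(\mathcal{G}^{(0)})$ is a twist over $\mathcal{G}^{(0)}$. (b) The interior $\mathcal{I}^{\mathcal{E}}$ of the isotropy of $\mathcal{E}$ is a twist over the interior $\mathcal{I}^{\mathcal{G}}$ of the isotropy of $\mathcal{G}$. (c) For each $u\in\mathcal{E}^{(0)}$, the isotropy group $\mathcal{I}^{\mathcal{E}}_u$ is a twist over the isotropy group $\mathcal{I}^{\mathcal{G}}_{q(u)}$.
   Context: A Hausdorff étale groupoid is a second-countable locally compact Hausdorff topological groupoid $\mathcal{G}$ with unit space $\mathcal{G}^{(0)}$ whose range and source maps $r,s\colon\mathcal{G}\to\mathcal{G}^{(0)}$ are local homeomorphisms. For a topological groupoid $\mathcal{G}$, $\mathrm{Iso}(\mathcal{G})=\{\gamma\in\mathcal{G}: r(\gamma)=s(\gamma)\}$, $\mathcal{I}^{\mathcal{G}}$ is the topological interior of $\mathrm{Iso}(\mathcal{G})$ in $\mathcal{G}$, and $\mathcal{I}^{\mathcal{G}}_u=\{\gamma\in\mathcal{I}^{\mathcal{G}}: r(\gamma)=s(\gamma)=u\}$ for a unit $u$; the same notation is used for $\mathcal{E}$. All subgroupoids carry the subspace topology. A twist $(\mathcal{E},i,q)$ over $\mathcal{G}$ is a sequence $\mathcal{G}^{(0)}\times\mathbb{T}\xrightarrow{i}\mathcal{E}\xrightarrow{q}\mathcal{G}$, where $\mathcal{G}^{(0)}\times\mathbb{T}$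 is the trivial group bundle with fibres $\mathbb{T}$ and $\mathcal{E}$ is a locally compact Hausdorff groupoid with $\mathcal{E}^{(0)}=i(\mathcal{G}^{(0)}\times\{1\})$, such that: (a) $i,q$ are continuous groupoid homomorphisms restricting to homeomorphisms of unit spaces ($\mathcal{E}^{(0)}$ is identified with $\mathcal{G}^{(0)}$ via $q$); (b) $i(\{x\}\times\mathbb{T})=q^{-1}(x)$ for $x\in\mathcal{G}^{(0)}$, $i$ is injective, $q$ is surjective; (c) each $\alpha\in\mathcal{G}$ has an open neighbourhood $U_\alpha$ and a continuous $P_\alpha\colon U_\alpha\to\mathcal{E}$ with $q\circ P_\alpha=\mathrm{id}_{U_\alpha}$ such that $(\beta,z)\mapsto i(r(\beta),z)P_\alpha(\beta)$ is a homeomorphism $U_\alpha\times\mathbb{T}\to q^{-1}(U_\alpha)$; (d) $i(r(\varepsilon),z)\varepsilon=\varepsilon\, i(s(\varepsilon),z)$ for all $\varepsilon\in\mathcal{E}$, $z\in\mathbb{T}$. *)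

(* Defs.v *)
From HB Require Import structures.
From mathcomp Require Import all_boot all_order all_algebra.
From mathcomp Require Import all_classical all_reals.
From mathcomp Require Import topology normedtype.
From mathcomp Require Import complex.

Set Implicit Arguments.
Unset Strict Implicit.
Unset Printing Implicit Defensive.

Import numFieldNormedType.Exports.
Import Order.TTheory GRing.Theory Num.Theory.

Local Open Scope classical_set_scope.
Local Open Scope ring_scope.
Local Open Scope complex_scope.

(* A subset [A : set X] used as a type is the sigma type [set_type A], which
   carries the subspace topology. *)

Definition homeomorphism (X Y : topologicalType) (f : X -> Y) : Prop :=
  continuous f /\ exists g : Y -> X, [/\ cancel f g, cancel g f & continuous g].

Definition homeomorphism_onto (X Y : topologicalType) (B : set Y)
    (f : X -> Y) : Prop :=
  exists2 g : X -> B, (forall x, set_val (g x) = f x) & homeomorphism g.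

Definition homeomorphism_from_onto (X Y : topologicalType) (A : set X)
    (B : set Y) (f : X -> Y) : Prop :=
  homeomorphism_onto B (sigL A f).

Fact continuous_at_pair (X Y Z : topologicalType) (f : X -> Y) (g : X -> Z) x :
  {for x, continuous f} -> {for x, continuous g} ->
  {for x, continuous (fun x => (f x, g x))}.
Proof. by move=> cf cg; apply: cvg_pair. Qed.

Definition local_homeomorphism (X Y : topologicalType) (f : X -> Y) : Prop :=
  forall x, exists U : set X,
    [/\ open U, U x, open (f @` U) & homeomorphism_from_onto U (f @` U) f].

(* A small category with all arrows invertible, seen through its arrows; an
   object is identified with its identity arrow. [gmul x y] is the product of
   [x] and [y] when [gsrc x = grng y]; its value on other pairs is arbitrary
   and unconstrained. *)
Record topGroupoid := TopGroupoid {
  garrow :> topologicalType;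
  grng : garrow -> garrow;
  gsrc : garrow -> garrow;
  gmul : garrow -> garrow -> garrow;
  ginv : garrow -> garrow;
  gsrc_rng : forall x, gsrc (grng x) = grng x;
  grng_src : forall x, grng (gsrc x) = gsrc x;
  grngM : forall x y, gsrc x = grng y -> grng (gmul x y) = grng x;
  gsrcM : forall x y, gsrc x = grng y -> gsrc (gmul x y) = gsrc y;
  gmulA : forall x y z, gsrc x = grng y -> gsrc y = grng z ->
    gmul x (gmul y z) = gmul (gmul x y) z;
  gmul_rng : forall x, gmul (grng x) x = x;
  gmul_src : forall x, gmul x (gsrc x) = x;
  grngV : forall x, grng (ginv x) = gsrc x;
  gsrcV : forall x, gsrc (ginv x) = grng x;
  gmulV : forall x, gmul x (ginv x) = grng x;
  gmulVg : forall x, gmul (ginv x) x = gsrc x;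
  gmul_continuous :
    continuous (fun p : [set p : garrow * garrow | gsrc p.1 = grng p.2] =>
                  gmul (set_val p).1 (set_val p).2);
  ginv_continuous : continuous ginv
}.

Section Groupoid.
Variable G : topGroupoid.

Definition units : set G := [set x | grng x = x].

Lemma units_rng (x : G) : grng x \in units.
Proof. by rewrite inE /units /= -[X in grng X = _]gsrc_rng grng_src gsrc_rng. Qed.

Lemma units_src (x : G) : gsrc x \in units.
Proof. by rewrite inE /units /= grng_src. Qed.

Definition rng_unit (x : G) : units := exist _ (grng x) (units_rng x).
Definition src_unit (x : G) : units := exist _ (gsrc x) (units_src x).

Definition hausdorff_etale : Prop :=
  [/\ @second_countable G, locally_compact [set: G], hausdorff_space G,
      local_homeomorphism rng_unit & local_homeomorphism src_unit].

Definition Iso : set G := [set x | grng x = gsrc x].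

Definition IsoInt : set G := interior Iso.

Definition IsoInt_at (u : G) : set G :=
  [set x | [/\ IsoInt x, grng x = u & gsrc x = u]].

End Groupoid.

Arguments units G : clear implicits.
Arguments Iso G : clear implicits.
Arguments IsoInt G : clear implicits.
Arguments IsoInt_at G u : clear implicits.

Definition groupoid_hom (G H : topGroupoid) (f : G -> H) : Prop :=
  forall x y : G, gsrc x = grng y ->
    gsrc (f x) = grng (f y) /\ f (gmul x y) = gmul (f x) (f y).

Section Subgroupoid.
Variables (G : topGroupoid) (A : set G).

Definition subgroupoid : Prop :=
  (forall x y, A x -> A y -> gsrc x = grng y -> A (gmul x y)) /\
  (forall x, A x -> A (ginv x)).

Hypothesis subA : subgroupoid.

Lemma subgroupoidV (x : A) : ginv (set_val x) \in A.
Proof. by rewrite inE; apply: subA.2; exact: set_valP. Qed.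

Lemma subgroupoid_rng (x : A) : grng (set_val x) \in A.
Proof.
rewrite inE -gmulV; apply: subA.1; rewrite ?grngV//; first exact: set_valP.
by apply: subA.2; exact: set_valP.
Qed.

Lemma subgroupoid_src (x : A) : gsrc (set_val x) \in A.
Proof.
rewrite inE -gmulVg; apply: subA.1; rewrite ?gsrcV//; last exact: set_valP.
by apply: subA.2; exact: set_valP.
Qed.

Definition sub_rng (x : A) : A := exist _ (grng (set_val x)) (subgroupoid_rng x).
Definition sub_src (x : A) : A := exist _ (gsrc (set_val x)) (subgroupoid_src x).
Definition sub_inv (x : A) : A := exist _ (ginv (set_val x)) (subgroupoidV x).
(* the default value [x] is only returned on pairs that are not composable *)
Definition sub_mul (x y : A) : A := insubd x (gmul (set_val x) (set_val y)).

Lemma val_sub_mul (x y : A) : gsrc (set_val x) = grng (set_val y) ->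
  set_val (sub_mul x y) = gmul (set_val x) (set_val y).
Proof.
move=> xy; rewrite [LHS]val_insubd ifT// inE.
by apply: subA.1 => //; exact: set_valP.
Qed.

Let src_rngE (x y : A) : sub_src x = sub_rng y ->
  gsrc (set_val x) = grng (set_val y).
Proof. by move=> /(congr1 set_val). Qed.

Fact sub_src_rng x : sub_src (sub_rng x) = sub_rng x.
Proof. by apply: val_inj; exact: gsrc_rng. Qed.

Fact sub_rng_src x : sub_rng (sub_src x) = sub_src x.
Proof. by apply: val_inj; exact: grng_src. Qed.

Fact sub_rngM x y : sub_src x = sub_rng y -> sub_rng (sub_mul x y) = sub_rng x.
Proof.
by move/src_rngE => xy; apply: val_inj; rewrite /= val_sub_mul// grngM.
Qed.

Fact sub_srcM x y : sub_src x = sub_rng y -> sub_src (sub_mul x y) = sub_src y.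
Proof.
by move/src_rngE => xy; apply: val_inj; rewrite /= val_sub_mul// gsrcM.
Qed.

Fact sub_mulA x y z : sub_src x = sub_rng y -> sub_src y = sub_rng z ->
  sub_mul x (sub_mul y z) = sub_mul (sub_mul x y) z.
Proof.
move/src_rngE => xy /src_rngE yz; apply: val_inj; rewrite -!set_valE.
by rewrite !val_sub_mul ?grngM ?gsrcM ?gmulA// val_sub_mul ?grngM ?gsrcM.
Qed.

Fact sub_mul_rng x : sub_mul (sub_rng x) x = x.
Proof.
apply: val_inj; rewrite -!set_valE val_sub_mul; last exact: gsrc_rng.
exact: gmul_rng.
Qed.

Fact sub_mul_src x : sub_mul x (sub_src x) = x.
Proof.
apply: val_inj; rewrite -!set_valE val_sub_mul; last exact/esym/grng_src.
exact: gmul_src.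
Qed.

Fact sub_rngV x : sub_rng (sub_inv x) = sub_src x.
Proof. by apply: val_inj; exact: grngV. Qed.

Fact sub_srcV x : sub_src (sub_inv x) = sub_rng x.
Proof. by apply: val_inj; exact: gsrcV. Qed.

Fact sub_mulV x : sub_mul x (sub_inv x) = sub_rng x.
Proof.
apply: val_inj; rewrite -!set_valE val_sub_mul; last exact/esym/grngV.
exact: gmulV.
Qed.

Fact sub_mulVg x : sub_mul (sub_inv x) x = sub_src x.
Proof.
apply: val_inj; rewrite -!set_valE val_sub_mul; last exact: gsrcV.
exact: gmulVg.
Qed.

Fact sub_mul_continuous :
  continuous (fun p : [set p : A * A | sub_src p.1 = sub_rng p.2] =>
                sub_mul (set_val p).1 (set_val p).2).
Proof.
apply: continuous_comp_initial.
pose T := [set p : A * A | sub_src p.1 = sub_rng p.2].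
pose S := [set p : G * G | gsrc p.1 = grng p.2].
pose f (p : A * A) : G * G := (set_val p.1, set_val p.2).
have fS (p : T) : f (set_val p) \in S.
  by rewrite inE /S /=; apply: src_rngE; exact: (set_valP p).
pose g (p : T) : S := exist _ (f (set_val p)) (fS p).
have -> : (set_val : A -> G) \o
    (fun p : T => sub_mul (set_val p).1 (set_val p).2) =
    (fun p : S => gmul (set_val p).1 (set_val p).2) \o g.
  apply/funext => p /=; apply: val_sub_mul; apply: src_rngE.
  exact: (set_valP p).
move=> p; apply: continuous_comp; last exact: gmul_continuous.
move: p; apply: continuous_comp_initial.
move=> p; apply: (@continuous_comp _ _ _ _ f); first exact: initial_continuous.
apply: continuous_at_pair.
  by apply: (@continuous_comp _ _ _ fst set_val); [exact: cvg_fst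
    | exact: initial_continuous].
by apply: (@continuous_comp _ _ _ snd set_val); [exact: cvg_snd
  | exact: initial_continuous].
Qed.

Fact sub_inv_continuous : continuous sub_inv.
Proof.
apply: continuous_comp_initial => x.
apply: (@continuous_comp _ _ _ set_val (@ginv G)).
  exact: initial_continuous.
exact: ginv_continuous.
Qed.

Definition sub_groupoid : topGroupoid :=
  TopGroupoid sub_src_rng sub_rng_src sub_rngM sub_srcM sub_mulA sub_mul_rng
    sub_mul_src sub_rngV sub_srcV sub_mulV sub_mulVg sub_mul_continuous
    sub_inv_continuous.

Lemma units_sub_groupoid (u : units sub_groupoid) :
  set_val (set_val u) \in units G.
Proof.
by have /(congr1 set_val) := set_valP u; rewrite inE.
Qed.

Definition units_incl (u : units sub_groupoid) : units G :=
  exist _ (set_val (set_val u)) (units_sub_groupoid u).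

End Subgroupoid.

Section Circle.
Variable R : realType.

(* ascribing [numFieldType] is what selects the topology of the complex norm *)
Definition Cplx : numFieldType := R[i].

Definition circle : set Cplx := [set z | `|z| = 1].

Fact circle_norm (z : circle) : `|set_val z| = 1.
Proof. exact: (set_valP z). Qed.

Fact circle1_subproof : (1 : Cplx) \in circle.
Proof. by rewrite inE /circle /= normr1. Qed.

Fact circleM_subproof (z w : circle) : set_val z * set_val w \in circle.
Proof. by rewrite inE /circle /= normrM !circle_norm mulr1. Qed.

Fact circleV_subproof (z : circle) : (set_val z)^-1 \in circle.
Proof. by rewrite inE /circle /= normfV circle_norm invr1. Qed.

Definition circle1 : circle := exist _ 1 circle1_subproof.
Definition circle_mul (z w : circle) : circle :=
  exist _ (set_val z * set_val w) (circleM_subproof z w).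
Definition circle_inv (z : circle) : circle :=
  exist _ (set_val z)^-1 (circleV_subproof z).

Fact circle_neq0 (z : circle) : set_val z != 0.
Proof. by rewrite -normr_eq0 circle_norm oner_eq0. Qed.

Fact circle_mul_continuous :
  continuous (fun p : circle * circle => circle_mul p.1 p.2).
Proof.
apply: continuous_comp_initial => p.
apply: (@cvgM _ (circle * circle)%type).
  by apply: (@continuous_comp _ _ _ fst set_val); [exact: cvg_fst
    | exact: initial_continuous].
by apply: (@continuous_comp _ _ _ snd set_val); [exact: cvg_snd
  | exact: initial_continuous].
Qed.

Fact circle_inv_continuous : continuous circle_inv.
Proof.
apply: continuous_comp_initial => z.
apply: cvgV; [exact: nbhs_filter | exact: circle_neq0 | exact: initial_continuous].
Qed.

End Circle.

Arguments circle : clear implicits.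
Arguments circle1 {R}.

Section TrivialBundle.
Variables (R : realType) (G : topGroupoid).

Let T := (units G * circle R)%type.
Let rng (p : T) : T := (p.1, circle1).
Let mul (p q : T) : T := (p.1, circle_mul p.2 q.2).
Let inv (p : T) : T := (p.1, circle_inv p.2).

Fact bundle_rng_idem x : rng (rng x) = rng x.
Proof. by []. Qed.

Fact bundle_rngM x y : rng x = rng y -> rng (mul x y) = rng x.
Proof. by []. Qed.

Fact bundle_srcM x y : rng x = rng y -> rng (mul x y) = rng y.
Proof. by move=> [xy]; rewrite /rng /= xy. Qed.

Fact bundle_mulA x y z : rng x = rng y -> rng y = rng z ->
  mul x (mul y z) = mul (mul x y) z.
Proof.
by move=> _ _; congr (_, _); apply: val_inj; exact: mulrA.
Qed.

Fact bundle_mul_rng x : mul (rng x) x = x.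
Proof.
by case: x => u z; congr (_, _); apply: val_inj; exact: mul1r.
Qed.

Fact bundle_mul_src x : mul x (rng x) = x.
Proof.
by case: x => u z; congr (_, _); apply: val_inj; exact: mulr1.
Qed.

Fact bundle_rngV x : rng (inv x) = rng x.
Proof. by []. Qed.

Fact bundle_mulV x : mul x (inv x) = rng x.
Proof.
by congr (_, _); apply: val_inj; apply: mulfV; exact: circle_neq0.
Qed.

Fact bundle_mulVx x : mul (inv x) x = rng x.
Proof.
by congr (_, _); apply: val_inj; apply: mulVf; exact: circle_neq0.
Qed.

Fact bundle_mul_continuous :
  continuous (fun p : [set p : T * T | rng p.1 = rng p.2] =>
                mul (set_val p).1 (set_val p).2).
Proof.
move=> p; apply: (@continuous_comp _ _ _ set_val (fun q : T * T => mul q.1 q.2)).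
  exact: initial_continuous.
apply: continuous_at_pair.
  by apply: (@continuous_comp _ _ _ fst fst); exact: cvg_fst.
apply: (@continuous_comp _ _ _ (fun q : T * T => (q.1.2, q.2.2))
  (fun z : circle R * circle R => circle_mul z.1 z.2)); last first.
  exact: circle_mul_continuous.
apply: continuous_at_pair.
  by apply: (@continuous_comp _ _ _ fst snd); [exact: cvg_fst | exact: cvg_snd].
by apply: (@continuous_comp _ _ _ snd snd); exact: cvg_snd.
Qed.

Fact bundle_inv_continuous : continuous inv.
Proof.
move=> p; apply: continuous_at_pair; first exact: cvg_fst.
apply: (@continuous_comp _ _ _ snd (@circle_inv R)); first exact: cvg_snd.
exact: circle_inv_continuous.
Qed.

Definition trivial_bundle : topGroupoid :=
  @TopGroupoid T rng rng mul inv bundle_rng_idem bundle_rng_idem bundle_rngM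
    bundle_srcM bundle_mulA bundle_mul_rng bundle_mul_src bundle_rngV bundle_rngV
    bundle_mulV bundle_mulVx bundle_mul_continuous bundle_inv_continuous.

End TrivialBundle.

Section Twist.
Variable R : realType.

Definition twist_trivialization (E G : topGroupoid)
    (i : trivial_bundle R G -> E) (U : set G) (P : U -> E)
    (p : U * circle R) : E :=
  gmul (i (rng_unit (set_val p.1), p.2)) (P p.1).

(* [(E, i, q)] is a twist over [G]; this presupposes that [G] is a Hausdorff
   etale groupoid, which is therefore made part of the notion. In [twist_central]
   the units [r(e)] and [s(e)] of [E] are identified through [q] with units of
   [G], namely [q(r(e)) = r(q(e))] and [q(s(e)) = s(q(e))]. *)
Record is_twist (E G : topGroupoid) (i : trivial_bundle R G -> E) (q : E -> G) :
    Prop := IsTwist {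
  twist_base : hausdorff_etale G;
  twist_locally_compact : locally_compact [set: E];
  twist_hausdorff : hausdorff_space E;
  twist_units : units E = i @` [set p | p.2 = circle1];
  twist_i_continuous : continuous i;
  twist_i_hom : groupoid_hom i;
  twist_i_units :
    homeomorphism_from_onto (units (trivial_bundle R G)) (units E) i;
  twist_q_continuous : continuous q;
  twist_q_hom : groupoid_hom q;
  twist_q_units : homeomorphism_from_onto (units E) (units G) q;
  twist_exact : forall x : units G,
    i @` [set p | p.1 = x] = q @^-1` [set set_val x];
  twist_i_inj : injective i;
  twist_q_surj : forall a, exists e, q e = a;
  twist_locally_trivial : forall a : G, exists (U : set G) (P : U -> E),
    [/\ open U, U a, continuous P, forall b, q (P b) = set_val b
      & homeomorphism_onto (q @^-1` U) (twist_trivialization i P)];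
  twist_central : forall (e : E) (z : circle R),
    gmul (i (rng_unit (q e), z)) e = gmul e (i (src_unit (q e), z))
}.

Section Restriction.
Variables (E G : topGroupoid) (i : trivial_bundle R G -> E) (q : E -> G).
Variables (A : set E) (B : set G) (subB : subgroupoid B).

Definition twist_restr_i
    (iA : forall p : trivial_bundle R (sub_groupoid subB),
      i (units_incl p.1, p.2) \in A)
    (p : trivial_bundle R (sub_groupoid subB)) : A :=
  exist _ (i (units_incl p.1, p.2)) (iA p).

Definition twist_restr_q (qB : forall e : A, q (set_val e) \in B) (e : A) : B :=
  exist _ (q (set_val e)) (qB e).

End Restriction.

Definition restricts_to_twist (E G : topGroupoid)
    (i : trivial_bundle R G -> E) (q : E -> G) (A : set E) (B : set G) : Prop :=
  exists (subA : subgroupoid A) (subB : subgroupoid B)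
    (iA : forall p : trivial_bundle R (sub_groupoid subB),
      i (units_incl p.1, p.2) \in A)
    (qB : forall e : A, q (set_val e) \in B),
    @is_twist (sub_groupoid subA) (sub_groupoid subB)
      (twist_restr_i iA) (twist_restr_q qB).

End Twist.

(* Main.v *)
(* For a subgroupoid B of G which is locally closed and etale in its own right,
   q^-1(B) is a twist over B: all the data restrict, the local trivialization
   over U restricting to one over U `&` B. Local triviality also gives a
   continuous local section of q through every point of E, so q is open; since
   q is moreover injective on units, Iso(E) = q^-1(Iso(G)), and taking interiors
   IsoInt(E) = q^-1(IsoInt(G)). Hence the three statements are the cases
   B = units, IsoInt(G) and IsoInt(G)_u. A locally closed B is etale once its
   range map is open onto its units, because local injectivity is inherited. *)
Require Import Defs.
From mathcomp Require Import all_boot all_order all_algebra.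
From mathcomp Require Import all_classical all_reals.
From mathcomp Require Import topology normedtype.

Import numFieldNormedType.Exports.

Set Implicit Arguments.
Unset Strict Implicit.

Local Open Scope classical_set_scope.

(** * Subspaces: continuity, separation, countability and compactness *)

Lemma continuous_set_val {X : topologicalType} (B : set X) :
  continuous (set_val : B -> X).
Proof. exact: initial_continuous. Qed.

Lemma continuous_into_subset {X Y : topologicalType} {B : set Y} (f : X -> B) :
  continuous (fun x => set_val (f x)) -> continuous f.
Proof. exact: continuous_comp_initial. Qed.

Lemma continuousT_comp {X Y Z : topologicalType} {f : X -> Y} {g : Y -> Z} :
  continuous f -> continuous g -> continuous (fun x => g (f x)).
Proof. by move=> cf cg x; apply: continuous_comp; [exact: cf|exact: cg]. Qed.

Lemma continuousT_pair {X Y Z : topologicalType} {f : X -> Y} {g : X -> Z} :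
  continuous f -> continuous g -> continuous (fun x => (f x, g x)).
Proof. by move=> cf cg x; apply: continuous_at_pair; [exact: cf|exact: cg]. Qed.

Lemma open_preimage {X Y : topologicalType} (f : X -> Y) (W : set Y) :
  continuous f -> open W -> open (f @^-1` W).
Proof. by move=> /continuousP; exact. Qed.

Lemma subset_hausdorff {X : topologicalType} (B : set X) :
  hausdorff_space X -> hausdorff_space B.
Proof.
move=> hX x y xy; apply: val_inj; rewrite -!set_valE; apply: hX => U V Ux Vy.
have [] := xy (set_val @^-1` U) (set_val @^-1` V).
- exact: continuous_set_val Ux.
- exact: continuous_set_val Vy.
by move=> z [Uz Vz]; exists (set_val z).
Qed.

Lemma subset_second_countable {X : topologicalType} (B : set X) :
  @second_countable X -> @second_countable B.
Proof.
move=> [C cC [oC bC]].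
exists [set set_val @^-1` U | U in C].
  exact: sub_countable (card_image_le _ _) cC.
split=> [_ [U CU <-]|x V].
  by apply: open_preimage; [exact: continuous_set_val|exact: oC].
move=> [_ [[W oW <-] Wx WV]].
have [|U [CU Ux] UW] := bC (set_val x) W; first exact: open_nbhs_nbhs.
exists (set_val @^-1` U); first by split => //; exists U.
by move=> y Uy; apply: WV; exact: UW.
Qed.

(** A filter on the subspace is pushed forward along [set_val]; its cluster point in [K] lies in
    [B], and subspace neighbourhoods are traces of ambient ones. *)
Lemma compact_subset {X : topologicalType} (B K : set X) :
  K `<=` B -> compact K -> compact (set_val @^-1` K : set B).
Proof.
move=> KB cK F FF FK.
have [p [Kp clp]] := cK (set_val @ F) _ FK.
exists (exist _ p (mem_set (KB _ Kp))).
split => // M N FM [_ [[W oW <-] Wp WN]].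
have [||_ [[y My <-] Wy]] := clp (set_val @` M) W.
- by apply: (@filterS _ F _ M) => // y My; exists y.
- exact: open_nbhs_nbhs.
by exists y; split => //; exact: WN.
Qed.

(** Regularity shrinks a compact neighbourhood of the point until its closure stays inside [O];
    cutting with the closed set [C] then keeps it compact and puts it inside [B]. *)
Lemma locally_closed_locally_compact {X : topologicalType} (O C : set X)
    (B : set X) :
  hausdorff_space X -> locally_compact [set: X] ->
  open O -> closed C -> B = O `&` C -> locally_compact [set: B].
Proof.
move=> hX lX oO cC BE x _.
have BOC (y : B) : (O `&` C) (set_val y) by move: (set_valP y); rewrite {1}BE.
have [Ox Cx] := BOC x.
have [V] := lX (set_val x) I; rewrite !withinET => Vx [cV clV].
have xO : nbhs (set_val x) O by exact: open_nbhs_nbhs.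
have [W Wx WO] := compact_regular hX cV Vx xO.
pose K := V `&` closure W `&` C.
have KB : K `<=` B by rewrite BE => y [[_ /WO]].
have clK : closed K by do 2!apply: closedI => //; exact: closed_closure.
exists (set_val @^-1` K); last split.
- have : nbhs x (set_val @^-1` (V `&` W)).
    by apply: continuous_set_val; exact: filterI.
  apply: filterS => y [Vy Wy].
  split; last by have [] := BOC y.
  by split => //; exact: subset_closure.
- apply: compact_subset => //; apply: subclosed_compact cV _ => //.
  by move=> y [[]].
- by apply: preimage_closed => // y _; exact: continuous_set_val.
Qed.

(** * Local homeomorphisms as open, locally injective maps *)

Definition open_map {X Y : topologicalType} (f : X -> Y) :=
  forall V, open V -> open (f @` V).

Definition locally_injective {X Y : topologicalType} (f : X -> Y) :=
  forall x, exists U, [/\ open U, U x & {in U &, injective f}].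

Lemma local_homeo_open {X Y : topologicalType} (f : X -> Y) :
  local_homeomorphism f -> open_map f.
Proof.
move=> lf V oV; rewrite openE => _ [x Vx <-].
have [U [oU Ux ofU [g gE [_ [h [gK hK ch]]]]]] := lf x.
have : open (h @^-1` (set_val @^-1` V)).
  by do 2!apply: open_preimage => //; exact: continuous_set_val.
(* On the image of [U], membership in the open set [W] means that the local inverse [h] lands in
   [V]. That image is itself open, so its intersection with [W] is a neighbourhood of [f x], and it
   lies in the image of [V]. *)
move=> [W oW WE].
have fUV y : U y -> V y -> W (f y).
  move=> Uy Vy; pose y' : U := exist _ y (mem_set Uy).
  have : (h @^-1` (set_val @^-1` V)) (g y') by rewrite /= gK.
  by rewrite -WE /= gE.
rewrite /interior nbhsE; exists (W `&` f @` U).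
  by split; [exact: openI|split; [exact: fUV|exists x]].
move=> z [Wz fUz]; pose z' : f @` U := exist _ z (mem_set fUz).
have : (set_val @^-1` W) z' by [].
rewrite WE /= => Vhz; exists (set_val (h z')) => //.
by have := gE (h z'); rewrite hK /sigL /= => <-.
Qed.

Lemma local_homeo_locally_injective {X Y : topologicalType} (f : X -> Y) :
  local_homeomorphism f -> locally_injective f.
Proof.
move=> lf x; have [U [oU Ux _ [g gE [_ [h [gK _ _]]]]]] := lf x.
exists U; split => // y z /[dup] yU + /[dup] zU + fyz => _ _.
pose y' : U := exist _ y yU; pose z' : U := exist _ z zU.
suff : y' = z' by move=> /(congr1 set_val).
by apply: (can_inj gK); apply: val_inj; rewrite -!set_valE !gE.
Qed.

(** Meant for [g] the range or source map of a subgroupoid and [h] the inclusion [units_incl]: the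
    codomain of [g] is not [Y], so [g] is compared with [f] only after applying [h]. *)
Lemma locally_injective_subset {X Y Z : topologicalType} {B : set X}
    (f : X -> Y) (g : B -> Z) (h : Z -> Y) :
  (forall x, h (g x) = f (set_val x)) ->
  locally_injective f -> locally_injective g.
Proof.
move=> hg lf x; have [U [oU Ux injU]] := lf (set_val x).
exists (set_val @^-1` U); split => //.
  by apply: open_preimage => //; exact: continuous_set_val.
move=> y z /set_mem Uy /set_mem Uz /(congr1 h) yz; apply: val_inj.
by apply: injU; [exact: mem_set|exact: mem_set|rewrite -!hg].
Qed.

(** On an open [U] where [f] is injective, the inverse [h] is chosen pointwise. The preimage of an
    open [V] under [h] is the image of the intersection of [V] and [U], so openness of [f] is
    exactly continuity of [h]. *)
Lemma open_map_local_homeo {X Y : topologicalType} (f : X -> Y) :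
  continuous f -> open_map f -> locally_injective f -> local_homeomorphism f.
Proof.
move=> cf of_ lf x; have [U [oU Ux injf]] := lf x.
exists U; split => //; first exact: of_.
have fU (y : U) : f (set_val y) \in f @` U.
  by rewrite inE; exists (set_val y) => //; exact: set_valP.
have hU (z : f @` U) : exists y : U, f (set_val y) = set_val z.
  by have [y Uy yz] := set_valP z; exists (exist _ y (mem_set Uy)).
have [h hE] := choice hU.
pose g (y : U) : f @` U := exist _ (f (set_val y)) (fU y).
exists g => //; split.
  apply: continuous_into_subset.
  by apply: continuousT_comp cf; exact: continuous_set_val.
exists h; split.
- by move=> y; apply: val_inj; apply: injf; [exact: valP|exact: valP|exact: hE].
- by move=> z; apply: val_inj; exact: hE.
apply: continuous_into_subset; apply/continuousP => V oV.
exists (f @` (V `&` U)); first by apply: of_; exact: openI.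
apply/seteqP; split=> z /=.
  move=> [y [Vy Uy] yz]; suff -> : set_val (h z) = y by [].
  by apply: injf; [exact: valP|exact: mem_set|rewrite hE yz].
by move=> Vhz; exists (set_val (h z)); [split => //; exact: set_valP|exact: hE].
Qed.

Lemma closed_equalizer {X Y : topologicalType} (f g : X -> Y) :
  hausdorff_space Y -> continuous f -> continuous g ->
  closed [set x | f x = g x].
Proof.
rewrite open_hausdorff => hY cf cg; rewrite -openC openE => x /= /eqP fgx.
have [[M N]/= [/set_mem Mx /set_mem Nx] [oM oN /eqP MN]] := hY _ _ fgx.
have Mfx : nbhs x (f @^-1` M) by apply: cf; exact: open_nbhs_nbhs.
have Ngx : nbhs x (g @^-1` N) by apply: cg; exact: open_nbhs_nbhs.
apply: filterS (filterI Mfx Ngx) => y [/= My Ny] fgy.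
by have : set0 (f y) by rewrite -MN; split; rewrite ?[in X in N X]fgy.
Qed.

(** * Units, inverses and continuity of the structure maps *)

Lemma units_grng {G : topGroupoid} (x : G) : units G (grng x).
Proof. exact: set_mem (units_rng x). Qed.

Lemma units_gsrc {G : topGroupoid} (x : G) : units G (gsrc x).
Proof. exact: set_mem (units_src x). Qed.

Lemma units_src_id {G : topGroupoid} (x : G) : units G x -> gsrc x = x.
Proof. by move=> ux; rewrite -[in LHS]ux gsrc_rng ux. Qed.

Lemma idempotent_unit {G : topGroupoid} (x : G) :
  gsrc x = grng x -> gmul x x = x -> units G x.
Proof.
move=> sr xx; rewrite /units /= -gmulV -[X in gmul X _]xx -gmulA ?grngV//.
by rewrite gmulV -sr gmul_src.
Qed.

Lemma ginv_uniq {G : topGroupoid} (x y : G) :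
  gsrc y = grng x -> gmul y x = gsrc x -> y = ginv x.
Proof.
move=> yx yxE; rewrite -[LHS]gmul_src yx -gmulV gmulA ?grngV// yxE.
by rewrite -grngV gmul_rng.
Qed.

Lemma ginvK {G : topGroupoid} : involutive (@ginv G).
Proof.
by move=> x; apply/esym/ginv_uniq; rewrite ?grngV// gmulV gsrcV.
Qed.

(** The range is [gmul x (ginv x)], a composite of the continuous product and inverse. *)
Lemma grng_continuous {G : topGroupoid} : continuous (@grng G).
Proof.
have xV (x : G) : (x, ginv x) \in [set p : G * G | gsrc p.1 = grng p.2].
  by rewrite inE /= grngV.
pose g x : [set p : G * G | gsrc p.1 = grng p.2] := exist _ (x, ginv x) (xV x).
rewrite (_ : @grng G = fun x => gmul (set_val (g x)).1 (set_val (g x)).2).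
  apply: (@continuousT_comp _ _ _ g _ _ (@gmul_continuous G)).
  apply: continuous_into_subset.
  exact: (continuousT_pair (fun x => cvg_id) (@ginv_continuous G)).
by apply/funext => x /=; rewrite gmulV.
Qed.

Lemma gsrc_continuous {G : topGroupoid} : continuous (@gsrc G).
Proof.
rewrite (_ : @gsrc G = fun x => grng (ginv x)).
  exact: continuousT_comp (@ginv_continuous G) grng_continuous.
by apply/funext => x; rewrite grngV.
Qed.

Lemma rng_unit_continuous {G : topGroupoid} : continuous (@rng_unit G).
Proof. by apply: continuous_into_subset; exact: grng_continuous. Qed.

Lemma src_unit_continuous {G : topGroupoid} : continuous (@src_unit G).
Proof. by apply: continuous_into_subset; exact: gsrc_continuous. Qed.

(** The product is continuous only on the subspace of composable pairs, so the rectangle found in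
    the full product controls [gmul x' y'] only where the pair is composable. *)
Lemma gmul_nbhs {G : topGroupoid} (x y : G) (W : set G) :
  gsrc x = grng y -> nbhs (gmul x y) W ->
  exists2 UV : set G * set G, nbhs x UV.1 /\ nbhs y UV.2 &
    forall x' y', UV.1 x' -> UV.2 y' -> gsrc x' = grng y' -> W (gmul x' y').
Proof.
move=> xy Wxy.
have xyS : (x, y) \in [set p : G * G | gsrc p.1 = grng p.2] by rewrite inE.
have [_ [[O oO <-] Oxy OW]] := @gmul_continuous G (exist _ (x, y) xyS) W Wxy.
have [UV UVxy UVO] : nbhs (x, y) O by exact: open_nbhs_nbhs.
exists UV => // x' y' Ux Vy xy'.
have xyS' : (x', y') \in [set p : G * G | gsrc p.1 = grng p.2] by rewrite inE.
by apply: (OW (exist _ (x', y') xyS')); apply: UVO.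
Qed.

Lemma units_closed {G : topGroupoid} : hausdorff_space G -> closed (units G).
Proof.
move=> hG; exact: (closed_equalizer hG grng_continuous (fun x => cvg_id)).
Qed.

Lemma rng_unit_src {G : topGroupoid} (x : G) : rng_unit (ginv x) = src_unit x.
Proof. by apply: val_inj; exact: grngV. Qed.

(** The source map is the range map after inversion, and inversion is a homeomorphism. *)
Lemma src_unit_open {G : topGroupoid} :
  open_map (@rng_unit G) -> open_map (@src_unit G).
Proof.
move=> rO V oV; rewrite (_ : _ @` V = @rng_unit G @` (@ginv G @^-1` V)).
  by apply: rO; apply: open_preimage => //; exact: ginv_continuous.
apply/seteqP; split=> _ [x Vx <-]; exists (ginv x); rewrite /= ?ginvK//.
  exact: rng_unit_src.
by rewrite -rng_unit_src ginvK.
Qed.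

(** * Groupoid homomorphisms *)

Section Homomorphism.
Context {G H : topGroupoid} {f : G -> H} (fM : groupoid_hom f).

(** The image of a unit is idempotent with equal source and range, hence a unit. From this,
    preserving composable products forces [f] to preserve ranges, sources and inverses. *)
Lemma hom_units x : units G x -> units H (f x).
Proof.
move=> ux; have sx := units_src_id ux.
have [sr ff] := @fM x x (etrans sx (esym ux)).
by apply: idempotent_unit => //; rewrite -ff -[X in gmul X]ux gmul_rng.
Qed.

Lemma hom_rng x : f (grng x) = grng (f x).
Proof.
have [<- _] := fM (gsrc_rng x).
by rewrite units_src_id//; apply: hom_units; exact: units_grng.
Qed.

Lemma hom_src x : f (gsrc x) = gsrc (f x).
Proof.
have [-> _] := fM (esym (grng_src x)).
by have := hom_units (units_gsrc x).
Qed.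

Lemma hom_inv x : f (ginv x) = ginv (f x).
Proof.
have [sr fE] := fM (gsrcV x).
by apply: ginv_uniq => //; rewrite -fE gmulVg hom_src.
Qed.

Lemma preimage_subgroupoid B : subgroupoid B -> subgroupoid (f @^-1` B).
Proof.
move=> [BM BV]; split=> [x y Bx By xy|x Bx] /=.
  by have [sr ->] := fM xy; exact: BM.
by rewrite hom_inv; exact: BV.
Qed.

End Homomorphism.

(** * Isotropy and étale subgroupoids *)

Lemma isotropy_closed {G : topGroupoid} (u : G) : hausdorff_space G ->
  closed ([set x : G | grng x = u] `&` [set x | gsrc x = u]).
Proof.
move=> hG; apply: closedI.
  exact: (closed_equalizer hG grng_continuous (@cst_continuous _ _ u)).
exact: (closed_equalizer hG gsrc_continuous (@cst_continuous _ _ u)).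
Qed.

Lemma IsoInt_atE {G : topGroupoid} (u : G) : IsoInt_at G u =
  IsoInt G `&` ([set x | grng x = u] `&` [set x | gsrc x = u]).
Proof. by apply/seteqP; split=> x; [case|case=> ? []]. Qed.

Section Etale.
Context {G : topGroupoid} (hG : hausdorff_etale G).

Lemma etale_hausdorff : hausdorff_space G. Proof. by case: hG. Qed.

Lemma etale_rng_open : open_map (@rng_unit G).
Proof. by case: hG => _ _ _ /local_homeo_open. Qed.

Lemma units_subgroupoid : subgroupoid (units G).
Proof.
split=> [x y ux uy|x ux].
  by rewrite (units_src_id ux) uy => ->; rewrite -[X in gmul X]uy gmul_rng.
rewrite -(@ginv_uniq _ x x) ?(units_src_id ux)//.
by rewrite -[X in gmul X]ux gmul_rng.
Qed.

(* For [c] near [x y], the openness of the range map provides [v] near [y^-1],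
   still in the interior of the isotropy, such that [c v] is near [x]. *)
Lemma IsoInt_subgroupoid : subgroupoid (IsoInt G).
Proof.
have oI : open (IsoInt G) by exact: open_interior.
split=> [x y Ix Iy xy|x Ix].
  have xyV : gsrc (gmul x y) = grng (ginv y) by rewrite gsrcM// grngV.
  have Ixy : nbhs (gmul (gmul x y) (ginv y)) (IsoInt G).
    rewrite -gmulA ?grngV// gmulV -xy gmul_src; exact: open_nbhs_nbhs.
  have [[U V]/= [Uxy Vy] UVI] := gmul_nbhs xyV Ixy.
  have IVy : nbhs (ginv y) (@ginv G @^-1` IsoInt G).
    by apply: ginv_continuous; rewrite ginvK; exact: open_nbhs_nbhs.
  have : nbhs (ginv y) (V `&` @ginv G @^-1` IsoInt G) by exact: filterI.
  rewrite nbhsE => -[N [oN Ny] NVI].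
  have Nxy : nbhs (gmul x y) (@src_unit G @^-1` (@rng_unit G @` N)).
    apply: src_unit_continuous; apply: open_nbhs_nbhs.
    split; first exact: etale_rng_open.
    by exists (ginv y) => //; apply: val_inj => /=; rewrite -xyV.
  apply: (@filterS _ (nbhs (gmul x y)) _ _ _ _ (filterI Uxy Nxy)).
  move=> c [Uc [v Nv vcE]].
  have vc : grng v = gsrc c := congr1 set_val vcE.
  have [Vv /interior_subset/=] := NVI _ Nv; rewrite /Iso /= grngV gsrcV => vI.
  (* Both [v] and [gmul c v] are isotropic, so r(c) = r(cv) = s(cv) = s(v) = r(v) = s(c). *)
  have := interior_subset (UVI _ _ Uc Vv (esym vc)).
  by rewrite /Iso /= grngM// gsrcM// vI vc.
have : nbhs (ginv x) (@ginv G @^-1` IsoInt G).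
  by apply: ginv_continuous; rewrite ginvK; exact: open_nbhs_nbhs.
by apply: filterS => y /interior_subset; rewrite /Iso /= grngV gsrcV.
Qed.

Lemma IsoInt_at_subgroupoid u : subgroupoid (IsoInt_at G u).
Proof.
split=> [x y [Ix xr xs] [Iy yr ys] xy|x [Ix xr xs]].
  by split; rewrite ?grngM ?gsrcM//; exact: IsoInt_subgroupoid.1.
by split; rewrite ?grngV ?gsrcV//; exact: IsoInt_subgroupoid.2.
Qed.

Lemma sub_groupoid_etale (B O C : set G) (subB : subgroupoid B) :
  open O -> closed C -> B = O `&` C ->
  open_map (@rng_unit (sub_groupoid subB)) ->
  hausdorff_etale (sub_groupoid subB).
Proof.
move=> oO cC BE rO; case: hG => scG lcG hsG lr ls; split.
- exact: subset_second_countable.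
- exact: locally_closed_locally_compact oO cC BE.
- exact: subset_hausdorff.
- apply: open_map_local_homeo => //; first exact: rng_unit_continuous.
  apply: (@locally_injective_subset _ _ _ _ (@rng_unit G) _
    (@units_incl _ _ subB)).
    by move=> x; exact: val_inj.
  exact: local_homeo_locally_injective lr.
- apply: open_map_local_homeo; first exact: src_unit_continuous.
    exact: src_unit_open.
  apply: (@locally_injective_subset _ _ _ _ (@src_unit G) _
    (@units_incl _ _ subB)).
    by move=> x; exact: val_inj.
  exact: local_homeo_locally_injective ls.
Qed.

Lemma units_incl_continuous (B : set G) (subB : subgroupoid B) :
  continuous (@units_incl G B subB).
Proof.
apply: continuous_into_subset.
have val_cont := @continuous_set_val _ (units (sub_groupoid subB)).
exact: (continuousT_comp val_cont (@continuous_set_val _ B)).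
Qed.

Lemma units_etale : hausdorff_etale (sub_groupoid units_subgroupoid).
Proof.
apply: (sub_groupoid_etale openT (units_closed etale_hausdorff)).
  by rewrite setTI.
(* Every arrow here is its own range, so [rng_unit] is the identity up to the coercion from units to
   arrows. *)
move=> V oV; rewrite (_ : _ @` V = set_val @^-1` V).
  by apply: open_preimage => //; exact: continuous_set_val.
have rE (x : sub_groupoid units_subgroupoid) : set_val (rng_unit x) = x.
  by apply: val_inj; exact: (set_valP x).
apply/seteqP; split=> [_ [x Vx <-]|x Vx].
  by move: Vx; rewrite -{1}(rE x).
by exists (set_val x) => //; apply: val_inj; exact: rE.
Qed.

Lemma IsoInt_etale : hausdorff_etale (sub_groupoid IsoInt_subgroupoid).
Proof.
have oI : open (IsoInt G) by exact: open_interior.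
apply: (sub_groupoid_etale oI closedT); first by rewrite setIT.
move=> _ [W oW <-].
(* Since the interior of the isotropy is open in [G], an open subset of it has an open image under
   the range map of [G]; this image is pulled back along [units_incl]. *)
rewrite (_ : _ @` _ =
  @units_incl _ _ IsoInt_subgroupoid @^-1` (@rng_unit G @` (W `&` IsoInt G))).
  apply: open_preimage; first exact: units_incl_continuous.
  by apply: etale_rng_open; exact: openI.
apply/seteqP; split=> [_ [x Wx <-]|u [x [Wx Ix] /(congr1 set_val) xu]].
  exists (set_val x); first by split => //; exact: set_valP.
  exact: val_inj.
by exists (exist _ x (mem_set Ix)) => //; do 2!apply: val_inj.
Qed.

(** The unit space has no point other than [u], so the range map sends a nonempty open set onto the
    whole unit space and the empty set to the empty set. *)
Lemma IsoInt_at_etale u :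
  hausdorff_etale (sub_groupoid (IsoInt_at_subgroupoid u)).
Proof.
have oI : open (IsoInt G) by exact: open_interior.
have cC := @isotropy_closed G u etale_hausdorff.
apply: (sub_groupoid_etale oI cC).
  exact: IsoInt_atE.
move=> V oV; case: (pselect (V !=set0)) => [[x Vx]|V0]; last first.
  rewrite (_ : _ @` V = set0); first exact: open0.
  by apply/seteqP; split => // _ [x Vx <-]; apply: V0; exists x.
rewrite (_ : _ @` V = setT); first exact: openT.
apply/seteqP; split => // v _; exists x => //; do 2!apply: val_inj.
have [_ xr _] := set_valP x; have [_ vr _] := set_valP (set_val v).
have vu := congr1 set_val (set_valP v).
exact: (etrans xr (etrans (esym vr) vu)).
Qed.

End Etale.

Lemma homeomorphism_ontoI {X Y : topologicalType} {B : set Y} (f : X -> Y)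
    (k : B -> X) :
  continuous f -> (forall x, B (f x)) -> continuous k ->
  (forall x b, set_val b = f x -> k b = x) ->
  (forall b, f (k b) = set_val b) -> homeomorphism_onto B f.
Proof.
move=> cf fB ck fK kK.
pose g x : B := exist _ (f x) (mem_set (fB x)).
exists g => //; split; first exact: continuous_into_subset.
by exists k; split => // [x|b]; [exact: fK|apply: val_inj; exact: kK].
Qed.

(** * The projection [q] of a twist: units, composability and openness *)

Section TwistTheory.
Context {R : realType} {E G : topGroupoid} {i : trivial_bundle R G -> E}.
Context {q : E -> G} (hE : is_twist i q).

Let qM : groupoid_hom q := twist_q_hom hE.

Lemma twist_qi p : q (i p) = set_val p.1.
Proof.
have : (i @` [set p' | p'.1 = p.1]) (i p) by exists p.
by rewrite (twist_exact hE).
Qed.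

(** A unit of [E] has the form i(x, 1), and [q] recovers x. This explicit inverse is what makes [q]
    injective on units. *)
Lemma twist_iq e (eu : units E e) : i (rng_unit (q e), circle1) = e.
Proof.
move: (eu); rewrite (twist_units hE) => -[[u z]/= -> <-].
congr (i (_, _)); apply: val_inj; rewrite /= twist_qi /=.
exact: (set_valP u).
Qed.

Lemma twist_q_units_inj e e' :
  units E e -> units E e' -> q e = q e' -> e = e'.
Proof. by move=> ue ue' qe; rewrite -(twist_iq ue) -(twist_iq ue') qe. Qed.

(** An equality of propositions, so that isotropy conditions in [E] can be rewritten as conditions
    in [G]; it rests on the injectivity of [q] on units. *)
Lemma twist_rng_eqP e u : units E u -> (grng e = u) = (grng (q e) = q u).
Proof.
move=> uu; rewrite -(hom_rng qM); apply/propext; split=> [->//|qru].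
by apply: twist_q_units_inj => //; exact: units_grng.
Qed.

Lemma twist_src_eqP e u : units E u -> (gsrc e = u) = (gsrc (q e) = q u).
Proof.
move=> uu; rewrite -(hom_src qM); apply/propext; split=> [->//|qru].
by apply: twist_q_units_inj => //; exact: units_gsrc.
Qed.

Lemma twist_i_composable_l p e :
  set_val p.1 = grng (q e) -> gsrc (i p) = grng e.
Proof.
move=> pe; apply: twist_q_units_inj; [exact: units_gsrc|exact: units_grng|].
by rewrite (hom_src qM) (hom_rng qM) twist_qi pe gsrc_rng.
Qed.

Lemma twist_i_composable_r p e :
  gsrc (q e) = set_val p.1 -> gsrc e = grng (i p).
Proof.
move=> pe; apply: twist_q_units_inj; [exact: units_gsrc|exact: units_grng|].
by rewrite (hom_src qM) (hom_rng qM) twist_qi -pe grng_src.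
Qed.

Lemma twist_q_trivialization (U : set G) (P : U -> E) b z :
  q (P b) = set_val b -> q (twist_trivialization i P (b, z)) = set_val b.
Proof.
move=> qPb; have ib : gsrc (i (rng_unit (set_val b), z)) = grng (P b).
  by apply: twist_i_composable_l; rewrite qPb.
by have [_ qE] := qM ib; rewrite [LHS]qE twist_qi qPb gmul_rng.
Qed.

(* Through [e = phi (b, z)] passes the continuous local section
   [phi (-, z)] of [q]. *)
Lemma twist_q_open : open_map q.
Proof.
move=> W oW; rewrite openE => _ [e We <-].
have [U [P [oU Uqe cP qP [g gE [cg [h [gK hK ch]]]]]]] :=
  twist_locally_trivial hE (q e).
pose e' : q @^-1` U := exist _ e (mem_set (Uqe : (q @^-1` U) e)).
set b := (h e').1; set z := (h e').2.
have bE : set_val b = q e.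
  rewrite -(twist_q_trivialization z (qP b)).
  by rewrite -gE /b /z -surjective_pairing hK.
have [N oN NE] : open ((fun b' : U => g (b', z)) @^-1` (set_val @^-1` W)).
  apply: open_preimage.
    apply: (continuousT_comp _ cg).
    by apply: continuousT_pair; [move=> x; exact: cvg_id|exact: cst_continuous].
  by apply: open_preimage => //; exact: continuous_set_val.
rewrite /interior nbhsE; exists (N `&` U).
  split; first exact: openI.
  split => //; rewrite -bE.
  change ((set_val @^-1` N) b); rewrite NE /=.
  by rewrite /b /z -surjective_pairing hK.
move=> a [Na Ua]; pose a' : U := exist _ a (mem_set Ua).
have : (set_val @^-1` N) a' by [].
rewrite NE /= => Wa; exists (set_val (g (a', z))) => //.
by rewrite gE twist_q_trivialization.
Qed.

(** Openness of [q] gives the inclusion from left to right, continuity the converse. *)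
Lemma preimage_interior (S : set G) : interior (q @^-1` S) = q @^-1` interior S.
Proof.
apply/seteqP; split=> [e|e Se].
  rewrite {1}/interior nbhsE => -[W [oW We] WS].
  rewrite /= /interior nbhsE; exists (q @` W).
    by split; [exact: twist_q_open|exists e].
  by move=> _ [e' We' <-]; exact: WS.
exact: (twist_q_continuous hE Se).
Qed.

Lemma twist_IsoInt : IsoInt E = q @^-1` IsoInt G.
Proof.
rewrite /IsoInt -preimage_interior; congr interior.
apply/seteqP; split=> e; rewrite /Iso /= => re.
  by rewrite -(hom_rng qM) re (hom_src qM).
by rewrite twist_rng_eqP ?(hom_src qM)//; exact: units_gsrc.
Qed.

Lemma twist_IsoInt_at u : units E u ->
  IsoInt_at E u = q @^-1` IsoInt_at G (q u).
Proof.
move=> uu; apply/seteqP; split=> e; rewrite /IsoInt_at /= twist_IsoInt.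
  by rewrite twist_rng_eqP// twist_src_eqP.
by rewrite twist_rng_eqP// twist_src_eqP.
Qed.

End TwistTheory.

(** * Restriction of a twist to a locally closed étale subgroupoid *)

Section TwistRestriction.
Context {R : realType} {E G : topGroupoid} {i : trivial_bundle R G -> E}.
Context {q : E -> G} (hE : is_twist i q).
Context (B O C : set G) (subB : subgroupoid B).
Hypotheses (oO : open O) (cC : closed C) (BE : B = O `&` C).
Hypothesis hB : hausdorff_etale (sub_groupoid subB).

Let A : set E := q @^-1` B.
Let qM : groupoid_hom q := twist_q_hom hE.
Let iM : groupoid_hom i := twist_i_hom hE.
Let subA : subgroupoid A := preimage_subgroupoid qM subB.
Let SA := sub_groupoid subA.
Let SB := sub_groupoid subB.

Let iA (p : trivial_bundle R SB) : i (units_incl p.1, p.2) \in A.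
Proof. by rewrite inE /A /= (twist_qi hE); exact: (set_valP (set_val p.1)). Qed.

Let qB (e : A) : q (set_val e) \in B.
Proof. by rewrite inE; exact: (set_valP e). Qed.

Let i' : trivial_bundle R SB -> SA := twist_restr_i iA.
Let q' : SA -> SB := twist_restr_q qB.

Let ci' : continuous i'.
Proof.
apply: continuous_into_subset.
apply: (continuousT_comp _ (twist_i_continuous hE)).
apply: continuousT_pair; last by move=> x; exact: cvg_snd.
apply: (continuousT_comp _ (@units_incl_continuous _ _ subB)).
by move=> x; exact: cvg_fst.
Qed.

Let cq' : continuous q'.
Proof.
apply: continuous_into_subset.
exact: (continuousT_comp (@continuous_set_val _ A) (twist_q_continuous hE)).
Qed.

Let q'i' p : q' (i' p) = set_val p.1.
Proof. by apply: val_inj; exact: (twist_qi hE). Qed.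

Let i'M : groupoid_hom i'.
Proof.
move=> x y xy.
have xy' : @gsrc (trivial_bundle R G) (units_incl x.1, x.2)
         = @grng (trivial_bundle R G) (units_incl y.1, y.2).
  by case: xy => xy; rewrite /= xy.
have [sr iE] := iM xy'; split; first exact: val_inj.
by apply: val_inj; rewrite -!set_valE /= val_sub_mul.
Qed.

Let q'M : groupoid_hom q'.
Proof.
move=> x y xy; have xyv := congr1 set_val xy.
have [sr qE] := qM xyv; split; first exact: val_inj.
apply: val_inj; rewrite -!set_valE [RHS]val_sub_mul//.
by rewrite -qE; congr q; exact: val_sub_mul.
Qed.

Let i'q' (e : SA) : units SA e -> i' (rng_unit (q' e), circle1) = e.
Proof.
move=> ue; apply: val_inj; rewrite -!set_valE.
rewrite -[RHS](twist_iq hE); last exact: (congr1 set_val ue).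
by congr (i (_, _)); apply: val_inj.
Qed.

Let i'_unit (u : units SB) : units SA (i' (u, circle1)).
Proof. by apply: (hom_units i'M). Qed.

Let unit_bundle_cont :
  continuous (fun u : units SB => i' (u, circle1)).
Proof.
apply: (continuousT_comp _ ci').
by apply: continuousT_pair; [move=> x; exact: cvg_id|exact: cst_continuous].
Qed.

Let i'_homeo :
  homeomorphism_from_onto (units (trivial_bundle R SB)) (units SA) i'.
Proof.
(* The inverse sends [e] to (q'(e), 1). Both uses of [rng_unit] act on elements that are already
   units: they supply the membership proof and keep [k] visibly continuous. *)
pose k (e : units SA) : units (trivial_bundle R SB) :=
  @rng_unit (trivial_bundle R SB) (rng_unit (q' (set_val e)), circle1).
apply: (homeomorphism_ontoI (k := k)).
- exact: (continuousT_comp (@continuous_set_val _ _) ci').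
- by move=> p; apply: (hom_units i'M); exact: set_valP.
- apply: (continuousT_comp _ rng_unit_continuous).
  apply: continuousT_pair; last exact: cst_continuous.
  apply: (continuousT_comp _ rng_unit_continuous).
  exact: (continuousT_comp (@continuous_set_val _ _) cq').
- move=> p e ep; apply: val_inj; have := set_valP p.
  rewrite /units /= => <-; congr (_, _); rewrite ep /sigL /= q'i'.
  by apply: val_inj; exact: (set_valP (set_val p).1).
- by move=> e; apply: i'q'; exact: set_valP.
Qed.

Let q'_homeo : homeomorphism_from_onto (units SA) (units SB) q'.
Proof.
(* The inverse of [q'] on units is u ↦ i'(u, 1), already a unit; [rng_unit] only packages it as
   one. *)
pose k (u : units SB) : units SA := rng_unit (i' (u, circle1)).
apply: (homeomorphism_ontoI (k := k)).
- exact: (continuousT_comp (@continuous_set_val _ _) cq').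
- by move=> p; apply: (hom_units q'M); exact: set_valP.
- exact: (continuousT_comp unit_bundle_cont rng_unit_continuous).
- move=> e u ue; apply: val_inj; transitivity (i' (u, circle1)).
    exact: i'_unit.
  rewrite -[RHS]i'q'; last exact: set_valP.
  congr (i' (_, _)); apply: val_inj; rewrite -!set_valE ue /=.
  by symmetry; apply: (hom_units q'M); exact: set_valP.
- move=> u; transitivity (q' (i' (u, circle1))); last by rewrite q'i'.
  by congr q'; exact: i'_unit.
Qed.

Let locally_trivial' (a : SB) : exists (U : set SB) (P : U -> SA),
  [/\ open U, U a, continuous P, forall b, q' (P b) = set_val b
    & homeomorphism_onto (q' @^-1` U) (twist_trivialization i' P)].
Proof.
have [U [P [oU Ua cP qP [g gE [cg [h [gK hK ch]]]]]]] :=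
  twist_locally_trivial hE (set_val a).
pose U' : set SB := set_val @^-1` U.
have U'U (b : U') : set_val (set_val b) \in U.
  by rewrite inE; exact: (set_valP b).
(* [up] and, below, [low] are the inclusions of the restricted base and total space into the ambient
   [U] and its preimage under [q]; the ambient trivialization is transported along them. *)
pose up (b : U') : U := exist _ (set_val (set_val b)) (U'U b).
have PA (b : U') : P (up b) \in A.
  by rewrite inE /A /= qP; exact: (set_valP (set_val b)).
pose P' (b : U') : SA := exist _ (P (up b)) (PA b).
have cup : continuous up.
  apply: continuous_into_subset.
  have val_cont := @continuous_set_val _ U'.
  exact: (continuousT_comp val_cont (@continuous_set_val _ B)).
have q'P' (b : U') : q' (P' b) = set_val b by apply: val_inj; exact: qP.
have trE (b : U') z : set_val (twist_trivialization i' P' (b, z))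
                    = twist_trivialization i P (up b, z).
  have iE : set_val (i' (rng_unit (set_val b), z))
          = i (rng_unit (set_val (up b)), z).
    by congr (i (_, _)); apply: val_inj.
  (* The restricted product returns a default value on other pairs, so composability has to be
     established before comparing it with the product of [E]. *)
  have sr : gsrc (set_val (i' (rng_unit (set_val b), z)))
          = grng (set_val (P' b)).
    by rewrite iE; apply: (twist_i_composable_l hE); rewrite qP.
  exact: (etrans (val_sub_mul subA sr) (congr1 (fun e => gmul e _) iE)).
have lowU (e : q' @^-1` U') : (q @^-1` U) (set_val (set_val e)).
  exact: (set_valP e).
pose low (e : q' @^-1` U') : q @^-1` U :=
  exist (fun e => e \in q @^-1` U) (set_val (set_val e)) (mem_set (lowU e)).
(* The base coordinate of [h (low e)] is only typed as a point of [U]. It equals the image of [e]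
   under [q], so [q'] provides it as a point of [U'], and only the circle coordinate is taken from
   [h]. *)
pose k (e : q' @^-1` U') : (U' * circle R)%type :=
  (exist (fun b => b \in U') (q' (set_val e)) (mem_set (set_valP e)),
   (h (low e)).2).
have clow : continuous low.
  apply: continuous_into_subset.
  exact: (continuousT_comp (@continuous_set_val _ _) (@continuous_set_val _ A)).
have kE e : (up (k e).1, (k e).2) = h (low e).
  rewrite [RHS]surjective_pairing; congr (_, _); apply: val_inj.
  rewrite -!set_valE /=.
  rewrite -(twist_q_trivialization hE (h (low e)).2 (qP (h (low e)).1)).
  by rewrite -gE -surjective_pairing hK.
exists U', P'; split => //.
- by apply: open_preimage => //; exact: continuous_set_val.
- by apply: continuous_into_subset; exact: continuousT_comp cup cP.
apply: (homeomorphism_ontoI (k := k)).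
- apply: continuous_into_subset.
  rewrite (_ : (fun _ => _) = fun p => set_val (g (up p.1, p.2))); last first.
    by apply/funext => -[b z]; rewrite [LHS]trE gE.
  apply: (continuousT_comp _ (@continuous_set_val _ _)).
  apply: (continuousT_comp _ cg).
  apply: continuousT_pair; last by move=> x; exact: cvg_snd.
  by apply: (continuousT_comp _ cup) => x; exact: cvg_fst.
- move=> [b z].
  have qE : q (set_val (twist_trivialization i' P' (b, z)))
          = set_val (set_val b).
    by rewrite trE (twist_q_trivialization hE).
  exact: (eq_ind_r U (set_valP b) qE).
- apply: continuousT_pair.
    apply: continuous_into_subset.
    exact: (continuousT_comp (@continuous_set_val _ _) cq').
  apply: (continuousT_comp (continuousT_comp clow ch)) => x; exact: cvg_snd.
- move=> [b z] e ebz.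
  have lowE : low e = g (up b, z).
    by apply: val_inj; rewrite -!set_valE gE -trE -ebz.
  have := kE e; rewrite lowE gK => -[be ze]; congr (_, _) => //.
  by do 2!apply: val_inj.
- move=> e; apply: val_inj; rewrite -!set_valE [k e]surjective_pairing trE.
  by rewrite kE -gE hK.
Qed.

Let central' (e : SA) (z : circle R) :
  gmul (i' (rng_unit (q' e), z)) e = gmul e (i' (src_unit (q' e), z)).
Proof.
have rE : set_val (i' (rng_unit (q' e), z)) = i (rng_unit (q (set_val e)), z).
  by congr (i (_, _)); apply: val_inj.
have sE : set_val (i' (src_unit (q' e), z)) = i (src_unit (q (set_val e)), z).
  by congr (i (_, _)); apply: val_inj.
have re : gsrc (set_val (i' (rng_unit (q' e), z))) = grng (set_val e).
  by rewrite rE; apply: (twist_i_composable_l hE).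
have es : gsrc (set_val e) = grng (set_val (i' (src_unit (q' e), z))).
  by rewrite sE; apply: (twist_i_composable_r hE).
apply: val_inj; rewrite -!set_valE.
apply: (etrans (val_sub_mul subA re)).
apply: etrans (esym (val_sub_mul subA es)).
by rewrite rE sE (twist_central hE).
Qed.

Lemma twist_restriction : restricts_to_twist i q (q @^-1` B) B.
Proof.
exists subA, subB, iA, qB; split.
- exact: hB.
- apply: (@locally_closed_locally_compact _ (q @^-1` O) (q @^-1` C)).
  + exact: twist_hausdorff hE.
  + exact: twist_locally_compact hE.
  + exact: open_preimage (twist_q_continuous hE) oO.
  + by apply: preimage_closed => // x _; exact: (twist_q_continuous hE).
  + by rewrite BE.
- exact: subset_hausdorff (twist_hausdorff hE).
- apply/seteqP; split=> [e ue|_ [[u z]/= -> <-]]; last exact: i'_unit.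
  by exists (rng_unit (q' e), circle1) => //; exact: i'q'.
- exact: ci'.
- exact: i'M.
- exact: i'_homeo.
- exact: cq'.
- exact: q'M.
- exact: q'_homeo.
- move=> x; apply/seteqP; split=> [_ [p px <-]|e ex].
    by rewrite /= [LHS]q'i' px.
  (* Exactness of the ambient twist writes [e] as i(x, z) with x seen in [G]; the same [z] works
     over the unit [x] of the subgroupoid. *)
  have : (i @` [set p | p.1 = units_incl x]) (set_val e).
    by rewrite (twist_exact hE); exact: (congr1 set_val ex).
  move=> [[u z]/= -> ize]; exists (x, z) => //.
  by apply: val_inj.
- move=> [u z] [v w] /(congr1 set_val) /(twist_i_inj hE) uzvw.
  have uv := congr1 (fun p => set_val p.1) uzvw.
  congr (_, _); last exact: (congr1 snd uzvw).
  by do 2!apply: val_inj.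
- move=> b; have [e qe] := twist_q_surj hE (set_val b).
  have Ae : A e by rewrite /A /= qe; exact: (set_valP b).
  by exists (exist _ e (mem_set Ae)); apply: val_inj.
- exact: locally_trivial'.
- exact: central'.
Qed.

End TwistRestriction.

Unset Implicit Arguments.

Theorem corollary2p11 (R : realType) (E G : topGroupoid)
    (i : trivial_bundle R G -> E) (q : E -> G)
    (hG : hausdorff_etale G) (hE : is_twist i q) :
  restricts_to_twist i q (q @^-1` (units G)) (units G) /\
  restricts_to_twist i q (IsoInt E) (IsoInt G) /\
  (forall u : E, units E u ->
     restricts_to_twist i q (IsoInt_at E u) (IsoInt_at G (q u))).
Proof.
(* In the three cases [B] is respectively closed, open, and the intersection of an open set with a
   closed one. *)
have cU := units_closed (etale_hausdorff hG).
have oI : open (IsoInt G) by exact: open_interior.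
split; [|split=> [|u uu]].
- apply: (twist_restriction hE openT cU _ (units_etale hG)).
  by rewrite setTI.
- rewrite (twist_IsoInt hE).
  apply: (twist_restriction hE oI closedT _ (IsoInt_etale hG)).
  by rewrite setIT.
- rewrite (twist_IsoInt_at hE uu).
  have cC := @isotropy_closed G (q u) (etale_hausdorff hG).
  exact: (twist_restriction hE oI cC (IsoInt_atE _) (IsoInt_at_etale hG _)).
Qed.
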